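(* Let $G$ be a finite simple graph with $n\ge 2$ vertices and no isolated vertices, let $0=\lambda_1\le\lambda_2\le\dots\le\lambda_n\le 2$ be the eigenvalues of its normalized Laplacian, and let $\tau:=\max_{i\neq 1}|1-\lambda_i|$. Then $$\tau=\max\{1-\lambda_2,\ \lambda_n-1\}.$$
   Context: For a simple graph $G=(V,E)$ on $n$ vertices without isolated vertices, with adjacency matrix $A$ and diagonal degree matrix $D$, the normalized Laplacian is $L:=\mathrm{Id}-D^{-1}A$. Its eigenvalues (counted with multiplicity) are real, lie in $[0,2]$, and are denoted $0=\lambda_1\le\lambda_2\le\dots\le\lambda_n\le 2$. In $\tau=\max_{i\ne1}|1-\lambda_i|$ the maximum is over indices $i\in\{2,\dots,n\}$. *)

(* Defs.v *)
From HB Require Import structures.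
From mathcomp Require Import all_boot all_order all_algebra.

Set Implicit Arguments.
Unset Strict Implicit.
Unset Printing Implicit Defensive.

Import Order.TTheory GRing.Theory Num.Theory.

Local Open Scope ring_scope.

Record simple_graph (V : finType) := SimpleGraph {
  edge :> rel V;
  edge_sym : symmetric edge;
  edge_irr : irreflexive edge }.

Definition degree (V : finType) (G : simple_graph V) (x : V) : nat :=
  #|[set y | G x y]|.

Definition no_isolated_vertex (V : finType) (G : simple_graph V) : Prop :=
  forall x : V, exists y : V, G x y.

(* Rows and columns are indexed by the vertices through [enum_val]. *)
Definition adjacency_mx (R : nzRingType) (V : finType) (G : simple_graph V) :
    'M[R]_#|V| :=
  \matrix_(i, j) (G (enum_val i) (enum_val j))%:R.

Definition degree_mx (R : nzRingType) (V : finType) (G : simple_graph V) :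
    'M[R]_#|V| :=
  diag_mx (\row_i (degree G (enum_val i))%:R).

Definition normalized_laplacian (R : comUnitRingType) (V : finType)
    (G : simple_graph V) : 'M[R]_#|V| :=
  1%:M - invmx (degree_mx R G) *m adjacency_mx R G.

(* The entries of [lam] are the eigenvalues of [M], each repeated according to
   its algebraic multiplicity, in nondecreasing order; indices start at 0, so
   that the k-th smallest eigenvalue is [lam`_k.-1]. *)
Definition ordered_spectrum (R : rcfType) (n : nat) (M : 'M[R]_n)
    (lam : n.-tuple R) : Prop :=
  sorted <=%R lam /\ char_poly M = \prod_(x <- lam) ('X - x%:P).

(* The maximum runs over all eigenvalues but the smallest one. The initial
   value 0 of the iterated maximum is harmless since the terms are nonnegative
   and there is at least one of them when [1 < n]. *)
Definition spectral_tau (R : rcfType) (n : nat) (lam : n.-tuple R) : R :=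
  \big[Num.max/0]_(1 <= i < n) `|1 - lam`_i|.

(* Main.v *)
Require Import Defs.
From HB Require Import structures.
From mathcomp Require Import all_boot all_order all_algebra.

Set Implicit Arguments.
Unset Strict Implicit.
Unset Printing Implicit Defensive.

Import Order.TTheory GRing.Theory Num.Theory.

Local Open Scope ring_scope.

(** The function [x |-> `|1 - x|] is the maximum of the decreasing function
    [1 - x] and the increasing function [x - 1]. On a nondecreasing family the
    former is largest at the first index and the latter at the last one, so
    over the indices [1 <= i < n] the maximum of [`|1 - lam`_i|] is reached at
    one of the two ends, as [1 - lam`_1] or as [lam`_n.-1 - 1]. These two
    numbers have the nonnegative sum [lam`_n.-1 - lam`_1], so the larger one is
    nonnegative, which matches the initial value 0 of the iterated maximum. *)

Lemma bigmax_dist_sorted (R : realDomainType) (c : R) (s : seq R) :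
    (1 < size s)%N -> sorted <=%R s ->
  \big[Num.max/0]_(1 <= i < size s) `|c - s`_i|
    = Num.max (c - s`_1) (s`_(size s).-1 - c).
Proof.
move=> s_gt1 s_sorted.
have last_lt : ((size s).-1 < size s)%N by rewrite ltn_predL ltnW.
have last_ge1 : (1 <= (size s).-1)%N by rewrite -ltnS prednK // ltnW.
have le_nth i j : (i <= j < size s)%N -> s`_i <= s`_j.
  case/andP=> le_ij lt_j; apply: (sorted_leq_nth le_trans lexx 0 s_sorted) => //.
  by rewrite inE (leq_ltn_trans le_ij).
have le_big i : (1 <= i < size s)%N ->
    `|c - s`_i| <= \big[Num.max/0]_(1 <= i < size s) `|c - s`_i|.
  move=> i_in; apply: (le_bigmax_seq 0 i xpredT (fun k => `|c - s`_k|));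
  by rewrite ?mem_index_iota.
apply/le_anti/andP; split; last first.
  rewrite ge_max; apply/andP; split.
    exact: le_trans (ler_norm _) (le_big 1%N s_gt1).
  apply: le_trans (le_big (size s).-1 _); first by rewrite distrC ler_norm.
  by rewrite last_ge1.
rewrite big_nat; apply: bigmax_le => [|i /andP[i_ge1 i_lt]].
  (* Two negative numbers would have a negative sum. *)
  rewrite leNgt gt_max !subr_lt0; apply/negP => /andP[lt_c1 lt_nc].
  by have := lt_trans lt_nc lt_c1; rewrite ltNge le_nth // last_ge1.
rewrite ler_norml lerNl opprB !le_max !lerD2r lerD2l lerN2 andbC.
by rewrite le_nth ?i_ge1 // le_nth ?orbT // last_lt andbT -ltnS prednK // ltnW.
Qed.

Theorem proposition3p1 (R : rcfType) (V : finType) (G : simple_graph V)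
    (hn : (2 <= #|V|)%N) (hG : no_isolated_vertex G)
    (lam : #|V|.-tuple R)
    (hlam : ordered_spectrum (normalized_laplacian R G) lam) :
  spectral_tau lam = Num.max (1 - lam`_1) (lam`_(#|V|.-1) - 1).
Proof.
case: hlam => lam_sorted _.
have := bigmax_dist_sorted 1 _ lam_sorted; rewrite size_tuple; exact.
Qed.
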